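(* (The Cosine Rule) Let $p\ge 0$ be an integer, and let $\gamma_\alpha=r_\alpha+i\varphi_\alpha$ and $\gamma_\beta=r_\beta+i\varphi_\beta$ be the complex lengths of the singular geodesics of a hyperbolic cone-manifold $W_p(\alpha,\beta)$ with cone angles $\alpha$ and $\beta$ respectively. Then $$\frac{\cos\frac{\varphi_\alpha}{2}\cosh\frac{r_\beta}{2}-\cos\frac{\varphi_\beta}{2}\cosh\frac{r_\alpha}{2}}{\cosh\frac{r_\alpha}{2}\cosh\frac{r_\beta}{2}-\cos\frac{\varphi_\alpha}{2}\cos\frac{\varphi_\beta}{2}}=\frac{\cos\alpha-\cos\beta}{1-\cos\alpha\cos\beta}.$$
   Context: A 3-dimensional hyperbolic cone-manifold is a Riemannian 3-manifold of constant sectional curvature $-1$ with cone-type singularities along simple closed geodesics, each singular component having a cone angle. For an integer $p\ge 0$, the twist link $W_p$ is the two-component two-bridge link in $S^3$ with slope $(4p+4)/(2p+1)$. $W_p(\alpha,\beta)$ is the cone-manifold with underlying space $S^3$ and singular set $W_p=\Sigma^1\cup\Sigma^2$, with cone angle $\alpha$ along $\Sigma^1$ and $\beta$ along $\Sigma^2$, where $0<\alpha,\beta\le\pi$. The fundamental group of $S^3\setminus W_p$ is $\Phi_p=\langle s,t\mid s l_s=l_s s\rangle=\langle s,t\mid t l_t=l_t t\rangle$, where $s,t$ are meridians of $\Sigma^1,\Sigma^2$ and $l_s,l_t$ the corresponding longitudes. With $[x,y]=xyx^{-1}y^{-1}$, $$l_s=[s,t]^{\frac{p+1}{2}}[s,t^{-1}]^{\frac{p+1}{2}}\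 (p\text{ odd}),\qquad l_s=s^{-1}[t,s]^{\frac p2}\,tst\,[s^{-1},t^{-1}]^{\frac p2}\ (p\text{ even}),$$ and $l_t$ is obtained by exchanging $s$ and $t$. If $W_p(\alpha,\beta)$ is hyperbolic, its holonomy homomorphism lifts to $h=h_{\alpha,\beta}:\Phi_p\to SL(2,\mathbf C)$, where $S=h(s)$ and $T=h(t)$ satisfy $\mathrm{tr}(S)=2\cos\frac\alpha2$, $\mathrm{tr}(T)=2\cos\frac\beta2$. Put $L_S=h(l_s)$, $L_T=h(l_t)$; these are loxodromic. The displacement of an isometry of $\mathbf H^3$ translating by $r$ along its axis and rotating by $\varphi$ about it is the complex number $r+i\varphi$. The complex length $\gamma_\alpha=r_\alpha+i\varphi_\alpha$ (resp. $\gamma_\beta=r_\beta+i\varphi_\beta$) of the singular component with cone angle $\alpha$ (resp. $\beta$) is the displacement of $L_S$ (resp. $L_T$), normalized so that $r_\alpha>0$ and $\cosh\frac{\gamma_\alpha}{2}=-\frac12\mathrm{tr}(L_S)$ (resp. $r_\beta>0$ and $\cosh\frac{\gamma_\beta}{2}=-\frac12\mathrm{tr}(L_T)$). Thus the eigenvalue of $L_S$ of modulus $>1$ is $-e^{\gamma_\alpha/2}$, and similarly for $L_T$. *)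

(* Defs.v *)
From HB Require Import structures.
From mathcomp Require Import all_boot all_order all_algebra.
From mathcomp Require Import all_classical all_reals all_analysis.
From mathcomp.real_closed Require Import complex.

Set Implicit Arguments.
Unset Strict Implicit.
Unset Printing Implicit Defensive.
Import Order.TTheory GRing.Theory Num.Theory.
Import numFieldNormedType.Exports.
Local Open Scope classical_set_scope.
Local Open Scope ring_scope.
Local Open Scope complex_scope.

Definition coshR (R : realType) (x : R) : R := (expR x + expR (- x)) / 2.
Definition sinhR (R : realType) (x : R) : R := (expR x - expR (- x)) / 2.

Definition expC (R : realType) (z : R[i]) : R[i] :=
  (expR (complex.Re z))%:C * (cos (complex.Im z) +i* sin (complex.Im z)).
Definition coshC (R : realType) (z : R[i]) : R[i] := (expC z + expC (- z)) / 2.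

(** * The link *)

(* The sphere is taken in R^4; `|x - y| below is the sup norm, which induces
   the same topology as the Euclidean one. *)
Definition sphere3 (R : realType) : set 'rV[R]_4 :=
  [set v | \sum_(i < 4) v 0 i ^+ 2 = 1].

(* The map (x, y) |-> (cos pi x, cos pi y, sin pi x sin pi y) identifies the
   pillowcase R^2 / G, where G is generated by the half-turns about the points
   of Z^2, with the surface w^2 = (1 - u^2) (1 - v^2), |u|, |v| <= 1, of R^3.
   This surface is star-shaped about 0, so that dividing by the Euclidean norm
   gives a homeomorphism onto S^2.  [pillow_point x y c] is the image of (x, y)
   on the round 2-sphere of S^3 at height c. *)
Definition pillow_point (R : realType) (x y c : R) : 'rV[R]_4 :=
  let u := cos (pi * x) in
  let v := cos (pi * y) in
  let w := sin (pi * x) * sin (pi * y) in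
  let k := Num.sqrt (1 - c ^+ 2) / Num.sqrt (u ^+ 2 + v ^+ 2 + w ^+ 2) in
  \row_(i < 4) [:: k * u; k * v; k * w; c]`_i.

(* The two-bridge link of slope a / b, for a even and coprime to b: on the
   pillowcase at height -1/2 the two arcs of slope a / b through the corners, on
   the one at height 1/2 the two arcs of slope 0, and between them the four
   vertical segments over the corners.  The component number j = 0, 1 is the one
   through the corners (0, j) and (1, j). *)
Definition two_bridge (R : realType) (a b j : nat) : set 'rV[R]_4 :=
  [set v | [\/ exists x y : R, a%:R * x - b%:R * y = j%:R
                           /\ v = pillow_point x y (- 2^-1),
               exists x : R, v = pillow_point x j%:R 2^-1
             | exists (m : 'I_2) (c : R), `|c| <= 2^-1
                           /\ v = pillow_point m%:R j%:R c]].

Definition twist_link (R : realType) (p j : nat) : set 'rV[R]_4 :=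
  @two_bridge R (4 * p + 4) (2 * p + 1) j.

Definition twist_link_complement (R : realType) (p : nat) : set 'rV[R]_4 :=
  @sphere3 R `\` (twist_link p 0 `|` twist_link p 1).

(** * Hyperbolic cone-manifolds *)

(* In cylindrical coordinates (r, theta, z) about a geodesic, where the metric is
   dr^2 + sinh^2 r dtheta^2 + cosh^2 r dz^2, this is cosh of the distance of two
   points of H^3. *)
Definition cosh_cyl (R : realType) (r1 u1 z1 r2 u2 z2 : R) : R :=
  coshR r1 * coshR r2 * coshR (z1 - z2)
  - sinhR r1 * sinhR r2 * cos (u1 - u2).

(* Some ball about x is isometric to a ball about a point of the axis in the
   hyperbolic cone of angle theta <= 2 pi, that is, in cylindrical coordinates
   with the angle taken modulo theta.  For theta = 2 pi the model is H^3. *)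
Definition cone_point (R : realType) (d : 'rV[R]_4 -> 'rV[R]_4 -> R)
    (theta : R) (x : 'rV[R]_4) : Prop :=
  exists (e : R) (k : R -> R -> R -> 'rV[R]_4),
  let dom (r z : R) := 0 <= r /\ coshR r * coshR z < coshR e in
  [/\ 0 < e,
      k 0 0 0 = x,
      forall r u z : R, dom r z ->
        sphere3 (k r u z) /\ k r (u + theta) z = k r u z,
      forall y, sphere3 y -> d x y < e ->
        exists r u z : R, dom r z /\ y = k r u z
    & forall r1 u1 z1 r2 u2 z2 : R, dom r1 z1 -> dom r2 z2 ->
        `|u1 - u2| <= theta / 2 ->
        coshR (d (k r1 u1 z1) (k r2 u2 z2)) = cosh_cyl r1 u1 z1 r2 u2 z2].

(* [d] is the Riemannian distance, restricted to the sphere, of a hyperbolic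
   cone-manifold with underlying space S^3 and singular set K1 u K2.  Midpoints
   and compactness make d a length metric. *)
Record hyperbolic_cone_metric (R : realType) (K1 K2 : set 'rV[R]_4)
    (alpha beta : R) (d : 'rV[R]_4 -> 'rV[R]_4 -> R) : Prop := {
  hcm_ge0 : forall x y, sphere3 x -> sphere3 y -> 0 <= d x y;
  hcm_eq0 : forall x y, sphere3 x -> sphere3 y -> (d x y = 0 <-> x = y);
  hcm_sym : forall x y, sphere3 x -> sphere3 y -> d x y = d y x;
  hcm_triangle : forall x y z, sphere3 x -> sphere3 y -> sphere3 z ->
    d x z <= d x y + d y z;
  hcm_topology : forall x (e : R), sphere3 x -> 0 < e ->
    (exists2 r : R, 0 < r & forall y, sphere3 y -> `|x - y| < r -> d x y < e) /\
    (exists2 r : R, 0 < r & forall y, sphere3 y -> d x y < r -> `|x - y| < e);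
  hcm_midpoint : forall x y, sphere3 x -> sphere3 y ->
    exists m, [/\ sphere3 m, d x m = d x y / 2 & d m y = d x y / 2];
  hcm_regular : forall x, sphere3 x -> ~ (K1 `|` K2) x ->
    cone_point d (2 * pi) x;
  hcm_singular1 : forall x, K1 x -> cone_point d alpha x;
  hcm_singular2 : forall x, K2 x -> cone_point d beta x
}.

(** * The link group *)

(* This is x y x^-1 y^-1, not the library's commutator x^-1 y^-1 x y. *)
Definition comm (G : groupType) (x y : G) : G := (x * y * x^-1 * y^-1)%g.

Definition longitude (p : nat) (G : groupType) (s t : G) : G :=
  (if odd p then comm s t ^+ (p.+1)./2 * comm s (t^-1) ^+ (p.+1)./2
   else s^-1 * comm t s ^+ p./2 * (t * s * t)
        * comm (s^-1) (t^-1) ^+ p./2)%g.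

(* (Phi, s, t) is presented by < s, t | s l_s = l_s s >. *)
Record twist_presentation (p : nat) (Phi : groupType) (s t : Phi) : Prop := {
  tp_relation : commute s (longitude p s t);
  tp_exists : forall (G : groupType) (a b : G),
    commute a (longitude p a b) ->
    exists f : Phi -> G, [/\ {morph f : x y / (x * y)%g}, f s = a & f t = b];
  tp_unique : forall (G : groupType) (f g : Phi -> G),
    {morph f : x y / (x * y)%g} -> {morph g : x y / (x * y)%g} ->
    f s = g s -> f t = g t -> f =1 g
}.

(* A universal covering of X with Phi acting as its group of deck
   transformations, which identifies Phi with the fundamental group of X. *)
Record universal_cover (R : realType) (X : set 'rV[R]_4) (Phi : groupType) := {
  uc_space : topologicalType;
  uc_proj : uc_space -> 'rV[R]_4;
  uc_act : Phi -> uc_space -> uc_space;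
  uc_range : range uc_proj = X;
  uc_continuous : continuous uc_proj;
  uc_open : forall U : set uc_space, open U ->
    exists2 V : set 'rV[R]_4, open V & uc_proj @` U = V `&` X;
  uc_act1 : forall e, uc_act 1%g e = e;
  uc_actM : forall g1 g2 e, uc_act (g1 * g2)%g e = uc_act g1 (uc_act g2 e);
  uc_act_continuous : forall g, continuous (uc_act g);
  uc_fiber : forall e1 e2,
    uc_proj e1 = uc_proj e2 <-> exists g, e2 = uc_act g e1;
  uc_discontinuous : forall e, exists U : set uc_space,
    [/\ open U, U e & forall g, g <> 1%g -> uc_act g @` U `&` U = set0];
  uc_connected : forall e1 e2, exists c : R -> uc_space,
    [/\ continuous c, c 0 = e1 & c 1 = e2];
  uc_simply_connected : forall c : R -> uc_space,
    continuous c -> c 0 = c 1 ->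
    exists H : R * R -> uc_space,
      [/\ continuous H,
          forall a : R, 0 <= a <= 1 -> H (0, a) = c a,
          forall a : R, 0 <= a <= 1 -> H (1, a) = c 0
        & forall b : R, 0 <= b <= 1 -> H (b, 0) = c 0 /\ H (b, 1) = c 0]
}.

(* m is a meridian and l a longitude of the singular component K of cone angle
   theta: a lift f of cylindrical coordinates from the punctured tubes about K to
   the universal covering unrolls the angle u and the length z along K, m
   increases u by theta, and l follows K once round, increasing z by the length
   of K (and u by some angle). *)
Definition meridian_longitude (R : realType) (X : set 'rV[R]_4)
    (Phi : groupType) (C : universal_cover X Phi)
    (d : 'rV[R]_4 -> 'rV[R]_4 -> R) (K : set 'rV[R]_4) (theta : R)
    (m l : Phi) : Prop :=
  exists (e : R) (f : R * R * R -> uc_space C) (len ang : R),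
  let dom := [set q : R * R * R | 0 < q.1.1 < e] in
  let pf r u z := uc_proj (f (r, u, z)) in
  [/\ 0 < e /\ 0 < len,
      {within dom, continuous f}
      /\ (forall r1 u1 z1 : R, 0 < r1 < e ->
           \forall q \near (r1, u1, z1),
             coshR (d (pf r1 u1 z1) (pf q.1.1 q.1.2 q.2))
             = cosh_cyl r1 u1 z1 q.1.1 q.1.2 q.2),
      forall rho : R, 0 < rho <= e -> forall y,
        (exists r u z : R, 0 < r < rho /\ y = pf r u z) <->
        [/\ sphere3 y, ~ K y & exists2 k, K k & d y k < rho],
      forall r1 u1 z1 r2 u2 z2 : R, 0 < r1 < e -> 0 < r2 < e ->
        pf r1 u1 z1 = pf r2 u2 z2 ->
        r1 = r2 /\ exists i j : int,
          u2 = u1 + theta *~ i + ang *~ j /\ z2 = z1 + len *~ j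
    & forall r u z : R, 0 < r < e ->
        uc_act m (f (r, u, z)) = f (r, u + theta, z)
        /\ uc_act l (f (r, u, z)) = f (r, u + ang, z + len)].

(** * Holonomy and complex length *)

Definition conj_transpose (R : realType) (A : 'M[R[i]]_2) : 'M[R[i]]_2 :=
  (map_mx (fun z => z^*) A)^T.

(* H^3 as the positive definite Hermitian matrices of determinant 1; SL(2, C)
   acts by X |-> A X A^*, and cosh of the distance of X and Y is tr(X Y^-1) / 2. *)
Definition hermitian_H3 (R : realType) : set 'M[R[i]]_2 :=
  [set X | [/\ conj_transpose X = X, \det X = 1 & 0 < \tr X]].

(* h is a lift to SL(2, C) of the holonomy of the hyperbolic structure given by d
   on X, D being the developing map. *)
Definition lifted_holonomy (R : realType) (X : set 'rV[R]_4)
    (Phi : groupType) (C : universal_cover X Phi)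
    (d : 'rV[R]_4 -> 'rV[R]_4 -> R) (h : Phi -> 'M[R[i]]_2) : Prop :=
  [/\ forall g1 g2, h (g1 * g2)%g = h g1 *m h g2,
      forall g, \det (h g) = 1
    & exists D : uc_space C -> 'M[R[i]]_2,
      [/\ forall e, hermitian_H3 (D e),
          forall e, exists U : set (uc_space C), [/\ open U, U e &
            forall e1 e2, U e1 -> U e2 ->
              \tr (D e1 *m invmx (D e2))
              = (2 * coshR (d (uc_proj e1) (uc_proj e2)))%:C]
        & forall g e, D (uc_act g e) = h g *m D e *m conj_transpose (h g)]].

(* The isometry +-L of H^3 translates by Re gamma along its axis and rotates by
   Im gamma about it. *)
Definition displacement (R : realType) (L : 'M[R[i]]_2) (gamma : R[i]) : Prop :=
  exists2 P : 'M[R[i]]_2, P \in unitmx & exists sgn : bool,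
    L = (-1) ^+ sgn *: (P *m diag_mx (\row_(j < 2)
          [:: expC (gamma / 2); expC (- gamma / 2)]`_j) *m invmx P).

Definition complex_length (R : realType) (L : 'M[R[i]]_2) (gamma : R[i]) : Prop :=
  [/\ displacement L gamma, 0 < complex.Re gamma & coshC (gamma / 2) = - (\tr L / 2)].

(* Main.v *)
Require Import Defs.
From HB Require Import structures.
From mathcomp Require Import all_boot all_order all_algebra.
From mathcomp Require Import all_classical all_reals all_analysis.
From mathcomp.real_closed Require Import complex.
From mathcomp Require Import ring lra.
Import Order.TTheory GRing.Theory Num.Theory.
Import numFieldNormedType.Exports.
Local Open Scope ring_scope.
Local Open Scope complex_scope.
Set Implicit Arguments.
Unset Strict Implicit.
Unset Printing Implicit Defensive.

(** Put x = tr S, y = tr T, z = tr ST and k = tr [S, T] - 2.  The relation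
    S L_S = L_S S implies the Tangent Rule in the polynomial form
      (2 z - x y)^2 (tr L_S + 2) = y^2 (x^2 - 4) (tr L_S - 2).
    To see this, conjugate L_S, hence also S, to diagonal form, and write the
    powers of the commutators in L_S as u A - v by Cayley-Hamilton, with the same
    u, v for all of them as all have trace 2 + k; the vanishing of an off-diagonal
    entry of L_S is then a relation between u, v and x, y, z.
    Since tr L_S = - 2 cosh (gamma / 2), one has
      |tr L_S + 2| = 2 (cosh (r / 2) - cos (phi / 2)),
      |tr L_S - 2| = 2 (cosh (r / 2) + cos (phi / 2)),
    and 2 z - x y is symmetric in S and T, so that the absolute values of the
    Tangent Rules for S and T give the Cosine Rule. *)

(** * Two by two matrices in coordinates *)

Definition mat2 (F : comNzRingType) (a b c d : F) : 'M[F]_2 :=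
  \matrix_(i, j) if i == 0 then if j == 0 then a else b
                 else if j == 0 then c else d.

Lemma mat2P (F : comNzRingType) (M N : 'M[F]_2) :
  M 0 0 = N 0 0 -> M 0 1 = N 0 1 -> M 1 0 = N 1 0 -> M 1 1 = N 1 1 -> M = N.
Proof.
move=> e00 e01 e10 e11; apply/matrixP.
have ord2P (i : 'I_2) : i = 0 \/ i = 1.
  by case: i => -[|[|//]] hi; [left|right]; apply: val_inj.
by move=> i j; case: (ord2P i) (ord2P j) => -> [->|->].
Qed.

Lemma mat2E (F : comNzRingType) (M : 'M[F]_2) :
  M = mat2 (M 0 0) (M 0 1) (M 1 0) (M 1 1).
Proof. by apply: mat2P; rewrite mxE. Qed.

Lemma mat2M (F : comNzRingType) (a b c d a' b' c' d' : F) :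
  mat2 a b c d * mat2 a' b' c' d' =
  mat2 (a * a' + b * c') (a * b' + b * d') (c * a' + d * c') (c * b' + d * d').
Proof.
by apply: mat2P; rewrite !mxE !big_ord_recl big_ord0 !mxE /= addr0.
Qed.

Lemma mat2_pencil (F : comNzRingType) (u v a b c d : F) :
  u *: mat2 a b c d - v%:M = mat2 (u * a - v) (u * b) (u * c) (u * d - v).
Proof. by apply: mat2P; rewrite !mxE /= ?mulr1n ?mulr0n ?subr0. Qed.

Lemma mxtrace_mat2 (F : comNzRingType) (a b c d : F) : \tr (mat2 a b c d) = a + d.
Proof. by rewrite /mxtrace !big_ord_recl big_ord0 !mxE addr0. Qed.

Lemma det_mat2 (F : comNzRingType) (a b c d : F) :
  \det (mat2 a b c d) = a * d - b * c.
Proof.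
rewrite (expand_det_row _ 0) !big_ord_recl big_ord0 /cofactor !det_mx11 !mxE /=.
by rewrite addr0 mul1r mulN1r mulrN.
Qed.

(** * The Tangent Rule when the image of the meridian is diagonal *)

(** The two factors of [L] stand for powers of [S, T] and [S, T^-1], and the quadratic relation
    between [u] and [v] says that each has determinant 1. Eliminating [v] with it leaves tr L - 2 =
    u^2 k (4 + k - y^2). The second conclusion serves to exclude x = y = z = 0, where it would give
    tr L = 2. *)
Lemma longitude_trace_odd (F : fieldType) (a b p q r s u v : F) :
  let S := mat2 a 0 0 b in let S' := mat2 b 0 0 a in
  let T := mat2 p q r s in let T' := mat2 s (- q) (- r) p in
  let L := (u *: (S * T * S' * T') - v%:M) * (u *: (S * T' * S' * T) - v%:M) in
  let x := a + b in let y := p + s in let z := a * p + b * s in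
  let k := q * r * (4 - x ^+ 2) in
  a * b = 1 -> p * s = 1 + q * r -> u ^+ 2 - (2 + k) * u * v + v ^+ 2 = 1 ->
  a != b -> L 0 1 = 0 -> \tr L != 2 ->
  (2 * z - x * y) ^+ 2 * (\tr L + 2) = y ^+ 2 * (x ^+ 2 - 4) * (\tr L - 2)
  /\ exists c, \tr L - 2 = c * (x ^+ 2 + z ^+ 2 - x * y * z).
Proof.
move=> S S' T T' L x y z k hab hps huv neq_ab L01 trL2.
have kE : k = x ^+ 2 + y ^+ 2 + z ^+ 2 - x * y * z - 4.
  rewrite /k /x /y /z; ring: hab hps.
have hv : v ^+ 2 = 1 - u ^+ 2 + (2 + k) * u * v.
  by apply: (addrI (u ^+ 2 - (2 + k) * u * v)); rewrite huv; ring.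
have trL : \tr L = u ^+ 2 * (2 + 4 * k + k ^+ 2 - k * y ^+ 2)
                   - 2 * u * v * (2 + k) + 2 * v ^+ 2.
  rewrite /L !mat2M !mat2_pencil mat2M mxtrace_mat2 /y /k /x.
  ring: hab hps.
have trLm2 : \tr L - 2 = u ^+ 2 * k * (x ^+ 2 + z ^+ 2 - x * y * z).
  have -> : x ^+ 2 + z ^+ 2 - x * y * z = 4 + k - y ^+ 2 by rewrite kE; ring.
  by rewrite trL hv; ring.
split; last by exists (u ^+ 2 * k).
have [u0 k0] : u != 0 /\ k != 0.
  apply/andP; apply: contraNT trL2; rewrite -(subr_eq0 (\tr L)) trLm2.
  rewrite negb_and !negbK.
  by case/orP=> /eqP ->; rewrite ?expr0n ?mulr0 !mul0r.
have q0 : q != 0 by apply: contraNneq k0 => q0; rewrite /k q0 !mul0r.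
(* The entry [L 0 1] is u q a (a - b) times a form linear in [u] and [v], with p - s as the
   coefficient of - v. One more factor a - b makes this form a polynomial in the traces, since (a -
   b) (p - s) = 2 z - x y. *)
have rel : u * (2 * z - x * y - k * (x * y - z)) = v * (2 * z - x * y).
  have c0 : u * q * a * (a - b) != 0.
    rewrite !mulf_neq0 ?subr_eq0 //.
    by apply: contra_eq_neq hab => ->; rewrite mul0r eq_sym oner_neq0.
  apply/eqP; rewrite -subr_eq0 -(mulrI_eq0 _ (lregP c0)); apply/eqP.
  transitivity ((a - b) * L 0 1); last by rewrite L01 mulr0.
  rewrite /L !mat2M !mat2_pencil mat2M mxE /= /x /y /z /k /x.
  ring: hab hps.
set d := 2 * z - x * y in rel *.
have d2 : d ^+ 2 = (x ^+ 2 - 4) * (y ^+ 2 - 4) + 4 * k by rewrite /d kE; ring.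
have trLp2 : \tr L + 2 = ((2 + k) * u - 2 * v) ^+ 2 - k * y ^+ 2 * u ^+ 2.
  (* The determinant relation makes tr L + 2 homogeneous of degree 2 in [u] and [v]. The square that
     appears is known after multiplication by [d], by [duv] below. *)
  have h2 : 2 = 2 * (u ^+ 2 - (2 + k) * u * v + v ^+ 2) by rewrite huv mulr1.
  by rewrite trL [X in _ + X = _]h2; ring.
have duv : d * ((2 + k) * u - 2 * v) = u * k * x * y.
  have -> : d * ((2 + k) * u - 2 * v) = (2 + k) * u * d - 2 * (v * d) by ring.
  by rewrite -rel /d; ring.
rewrite trLm2 trLp2 mulrBr -exprMn duv.
have -> : x ^+ 2 + z ^+ 2 - x * y * z = 4 + k - y ^+ 2 by rewrite kE; ring.
by rewrite [d ^+ 2 * _]mulrC d2; ring.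
Qed.

(** The same elimination works with [V] in place of [v]: both [L 0 1] and tr L - 2 then factor. If
    [u] and [v] come from A^n = u A - v, the next power has leading coefficient (2 + k) u - v, so
    [V] is the difference of two consecutive leading coefficients. *)
Lemma longitude_trace_even (F : fieldType) (a b p q r s u v : F) :
  let S := mat2 a 0 0 b in let S' := mat2 b 0 0 a in
  let T := mat2 p q r s in let T' := mat2 s (- q) (- r) p in
  let L := S' * (u *: (T * S * T' * S') - v%:M) * (T * S * T)
           * (u *: (S' * T' * S * T) - v%:M) in
  let x := a + b in let y := p + s in let z := a * p + b * s in
  let k := q * r * (4 - x ^+ 2) in
  a * b = 1 -> p * s = 1 + q * r -> u ^+ 2 - (2 + k) * u * v + v ^+ 2 = 1 ->
  a != b -> L 0 1 = 0 -> \tr L != 2 ->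
  (2 * z - x * y) ^+ 2 * (\tr L + 2) = y ^+ 2 * (x ^+ 2 - 4) * (\tr L - 2)
  /\ exists c, \tr L - 2 = c * (x ^+ 2 + z ^+ 2 - x * y * z).
Proof.
move=> S S' T T' L x y z k hab hps huv neq_ab L01 trL2.
have kE : k = x ^+ 2 + y ^+ 2 + z ^+ 2 - x * y * z - 4.
  rewrite /k /x /y /z; ring: hab hps.
(* In terms of V, the norm form u^2 - (2 + k) u v + v^2 is V^2 + k u V - k u^2. *)
pose V := v - (1 + k) * u.
have trL : \tr L = (y ^+ 2 - 2 - k) * V ^+ 2 + 2 * k * u * V - 2 * k * u ^+ 2.
  rewrite /L !mat2M !mat2_pencil !mat2M mxtrace_mat2 /V /y /k /x.
  ring: hab hps.
have rel0 : a * L 0 1 = q * V * (z * V - (2 * z - x * y) * u).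
  rewrite /L !mat2M !mat2_pencil !mat2M mxE /= /x /y /z /V /k /x.
  ring: hab hps.
set d := 2 * z - x * y in rel0 *.
have d2 : d ^+ 2 = (x ^+ 2 - 4) * (y ^+ 2 - 4) + 4 * k by rewrite /d kE; ring.
have h2 : 2 = 2 * (V ^+ 2 + k * u * V - k * u ^+ 2).
  by rewrite -[LHS]mulr1 -[X in _ * X = _]huv /V; ring.
have e4 : x ^+ 2 + z ^+ 2 - x * y * z = 4 + k - y ^+ 2 by rewrite kE; ring.
have trLm2 : \tr L - 2 = - V ^+ 2 * (x ^+ 2 + z ^+ 2 - x * y * z).
  by rewrite trL [X in _ - X = _]h2 e4; ring.
have trLp2 : \tr L + 2 = (y ^+ 2 - k) * V ^+ 2 + 4 * k * u * V - 4 * k * u ^+ 2.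
  by rewrite trL [X in _ + X = _]h2; ring.
split; last by exists (- V ^+ 2).
rewrite trLm2 trLp2 e4.
have V0 : V != 0.
  apply: contraNneq trL2 => V0.
  by rewrite -(subr_eq0 (\tr L)) trLm2 V0 expr0n oppr0 mul0r.
(* Here tr L != 2 does not exclude k = 0. If q = 0, then T is triangular and d^2 = (x^2 - 4) (y^2 -
   4) already gives the claim. *)
have [q0|q0] := eqVneq q 0.
  have k0 : k = 0 by rewrite /k q0 !mul0r.
  by rewrite d2 k0; ring.
have rel : d * u = z * V.
  apply/eqP; rewrite eq_sym -subr_eq0.
  by rewrite -(mulrI_eq0 _ (lregP (mulf_neq0 q0 V0))) -rel0 L01 mulr0.
have -> : d ^+ 2 * ((y ^+ 2 - k) * V ^+ 2 + 4 * k * u * V - 4 * k * u ^+ 2) =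
  (y ^+ 2 - k) * V ^+ 2 * d ^+ 2 + 4 * k * d * V * (d * u) - 4 * k * (d * u) ^+ 2.
  by ring.
rewrite rel.
transitivity (V ^+ 2 * (y ^+ 2 * d ^+ 2 - k * (2 * z - d) ^+ 2)); first by ring.
by rewrite d2 /d; ring.
Qed.

(** * Powers of commutators and representations into SL(2) *)

(** By Cayley-Hamilton, A (u A - v) = (m u - v) A - u, a recursion that depends on [A] only through
    its trace [m]. The quadratic relation is det (u A - v) = 1. *)
Lemma mat2_pow (F : comNzRingType) (m : F) (n : nat) :
  exists u v : F, u ^+ 2 - m * u * v + v ^+ 2 = 1 /\
    forall A : 'M[F]_2, \det A = 1 -> \tr A = m -> A ^+ n = u *: A - v%:M.
Proof.
elim: n => [|n [u [v [huv IH]]]].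
  exists 0, (- 1); split=> [|A _ _]; first by ring.
  by rewrite expr0 scale0r sub0r raddfN opprK.
exists (m * u - v), u; split; first by rewrite -huv; ring.
move=> A dA tA; rewrite exprS IH //.
rewrite [A]mat2E in dA tA *; move: dA tA.
rewrite det_mat2 mxtrace_mat2 !mat2_pencil mat2M.
set a := A 0 0; set b := A 0 1; set c := A 1 0; set d := A 1 1 => dA tA.
have bc : b * c = a * d - 1 by rewrite -dA; ring.
by rewrite -tA; congr mat2; ring: bc.
Qed.

Section LongitudeTrace.

Variables (F : fieldType) (G : groupType) (h : G -> 'M[F]_2).
Hypothesis hM : forall g1 g2, h (g1 * g2)%g = h g1 *m h g2.
Hypothesis hdet : forall g, \det (h g) = 1.

Lemma sl2_rep1 : h 1%g = 1.
Proof.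
have u1 : h 1%g \is a GRing.unit by rewrite unitmxE hdet unitr1.
by apply: (mulrI u1); rewrite mulr1 -[RHS]/(h 1%g) -{3}[1%g]mulg1 hM.
Qed.

Lemma sl2_repX g n : h (g ^+ n)%g = h g ^+ n.
Proof. by elim: n => [|n IH]; rewrite ?expg0 ?sl2_rep1 // expgS hM IH exprS. Qed.

Lemma sl2_repV g a b c d : h g = mat2 a b c d -> h g^-1%g = mat2 d (- b) (- c) a.
Proof.
move=> hg; have ug : h g \is a GRing.unit by rewrite unitmxE hdet unitr1.
apply: (mulrI ug); rewrite -[LHS]hM mulgV sl2_rep1 hg mat2M.
have := hdet g; rewrite hg det_mat2 => dg.
have -> : 1 = mat2 1 0 0 1 :> 'M[F]_2 by apply: mat2P; rewrite !mxE.
by congr mat2; rewrite -?dg; ring.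
Qed.

Lemma longitude_trace_diag p (s t : G) a b :
  h s = mat2 a 0 0 b -> a != b ->
  let L := h (longitude p s t) in
  let x := \tr (h s) in let y := \tr (h t) in let z := \tr (h s *m h t) in
  L 0 1 = 0 -> \tr L != 2 ->
  (2 * z - x * y) ^+ 2 * (\tr L + 2) = y ^+ 2 * (x ^+ 2 - 4) * (\tr L - 2)
  /\ exists c, \tr L - 2 = c * (x ^+ 2 + z ^+ 2 - x * y * z).
Proof.
move=> hs neq_ab L x y z.
have hsV := sl2_repV hs; rewrite oppr0 in hsV.
have [p0 [q [r [s0 ht]]]] : exists p0 q r s0, h t = mat2 p0 q r s0.
  by exists (h t 0 0), (h t 0 1), (h t 1 0), (h t 1 1); exact: mat2E.
have htV := sl2_repV ht.
have hab : a * b = 1 by have := hdet s; rewrite hs det_mat2 mul0r subr0.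
have hps : p0 * s0 = 1 + q * r by rewrite -(hdet t) ht det_mat2; ring.
have ex : x = a + b by rewrite /x hs mxtrace_mat2.
have ey : y = p0 + s0 by rewrite /y ht mxtrace_mat2.
have ez : z = a * p0 + b * s0.
  by rewrite /z hs ht [_ *m _]mat2M mxtrace_mat2; ring.
set k := q * r * (4 - x ^+ 2).
have hcomm g1 g2 : h (Defs.comm g1 g2) = h g1 * h g2 * h g1^-1%g * h g2^-1%g.
  by rewrite /Defs.comm !hM.
have [u [v [huv hpow]]] := mat2_pow (2 + k) (if odd p then p.+1./2 else p./2).
(* Each of the four commutators is conjugate to [S, T] or to its inverse, and inversion preserves
   traces in SL(2). *)
have tr_st : \tr (h (Defs.comm s t)) = 2 + k.
  rewrite hcomm hs hsV ht htV !mat2M mxtrace_mat2 /k ex; ring: hab hps.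
have tr_sV : \tr (h (Defs.comm s t^-1%g)) = 2 + k.
  rewrite hcomm invgK hs hsV ht htV !mat2M mxtrace_mat2 /k ex; ring: hab hps.
have tr_ts : \tr (h (Defs.comm t s)) = 2 + k.
  rewrite hcomm hs hsV ht htV !mat2M mxtrace_mat2 /k ex; ring: hab hps.
have tr_VV : \tr (h (Defs.comm s^-1%g t^-1%g)) = 2 + k.
  rewrite hcomm !invgK hs hsV ht htV !mat2M mxtrace_mat2 /k ex; ring: hab hps.
rewrite {}/L /longitude.
rewrite ey ez /k ex in huv hpow tr_st tr_sV tr_ts tr_VV *.
case: ifP hpow => _ hpow.
  rewrite hM !sl2_repX !hpow // !hcomm invgK hs hsV ht htV => L01 trL2.
  exact: (longitude_trace_odd hab hps huv neq_ab L01 trL2).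
rewrite !hM !sl2_repX !hpow // !hcomm !invgK hs hsV ht htV => L01 trL2.
exact: (longitude_trace_even hab hps huv neq_ab L01 trL2).
Qed.

End LongitudeTrace.

Lemma diag_commute (F : idomainType) (l1 l2 : F) (M : 'M[F]_2) :
  l1 != l2 -> mat2 l1 0 0 l2 *m M = M *m mat2 l1 0 0 l2 ->
  M = mat2 (M 0 0) 0 0 (M 1 1).
Proof.
move=> ne /matrixP comm; have := (comm 0 1, comm 1 0).
rewrite [M]mat2E [mat2 l1 _ _ _ *m _]mat2M [_ *m mat2 l1 _ _ _]mat2M !mxE /=.
rewrite !mul0r !mulr0 !addr0 !add0r => -[e1 e2]; congr mat2.
  apply/eqP; rewrite -(mulrI_eq0 _ (lregP (_ : l1 - l2 != 0))) ?subr_eq0 //.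
  by rewrite mulrBl e1 mulrC subrr.
apply/eqP; rewrite -(mulrI_eq0 _ (lregP (_ : l1 - l2 != 0))) ?subr_eq0 //.
by rewrite mulrBl e2 mulrC subrr.
Qed.

(** As [l1] and [l2] are distinct, anything that commutes with L is diagonal in the same basis, in
    particular S. Then x^2 != 4 separates the eigenvalues of S, and the claim, which involves only
    traces, is invariant under the conjugation by [P]. *)
Lemma longitude_trace (F : fieldType) (G : groupType) (h : G -> 'M[F]_2)
    (p : nat) (s t : G) (P : 'M[F]_2) (l1 l2 : F) :
  (forall g1 g2, h (g1 * g2)%g = h g1 *m h g2) -> (forall g, \det (h g) = 1) ->
  commute s (longitude p s t) ->
  let L := h (longitude p s t) in
  let x := \tr (h s) in let y := \tr (h t) in let z := \tr (h s *m h t) in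
  P \in unitmx -> L = P *m mat2 l1 0 0 l2 *m invmx P -> l1 != l2 ->
  x ^+ 2 != 4 -> \tr L != 2 ->
  (2 * z - x * y) ^+ 2 * (\tr L + 2) = y ^+ 2 * (x ^+ 2 - 4) * (\tr L - 2)
  /\ exists c, \tr L - 2 = c * (x ^+ 2 + z ^+ 2 - x * y * z).
Proof.
move=> hM hdet csl L x y z uP eL ne_l x24 trL2.
pose h' g := invmx P *m h g *m P.
have trh' g : \tr (h' g) = \tr (h g).
  by rewrite mxtrace_mulC mulmxA mulmxV // mul1mx.
have hM' g1 g2 : h' (g1 * g2)%g = h' g1 *m h' g2.
  by rewrite /h' hM !mulmxA mulmxK.
have hdet' g : \det (h' g) = 1.
  by rewrite !det_mulmx hdet mulr1 -det_mulmx mulVmx // det1.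
have eL' : h' (longitude p s t) = mat2 l1 0 0 l2.
  by rewrite /h' -/L eL !mulmxA mulVmx // mul1mx mulmxKV.
have hs' : h' s = mat2 (h' s 0 0) 0 0 (h' s 1 1).
  by apply: (diag_commute ne_l); rewrite -eL' -!hM' csl.
have ne_ab : h' s 0 0 != h' s 1 1.
  apply: contra_neq x24 => e; have := hdet' s; rewrite /x -trh' hs' -e.
  rewrite det_mat2 mxtrace_mat2 => d1.
  by rewrite -[RHS]mulr1 -[X in _ = _ * X]d1; ring.
have L01 : h' (longitude p s t) 0 1 = 0 by rewrite eL' mxE.
have := longitude_trace_diag hM' hdet' hs' ne_ab L01.
by rewrite -hM' !trh' hM; apply.
Qed.

(** * Deck transformations and complex lengths *)

(** Both elements act on the coordinates (r, u, z) of the tube by translations, and these commute.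
    Deck transformations that agree at one point are equal, because the action is free. *)
Lemma meridian_longitude_commute (R : realType) (X : set 'rV[R]_4) (Phi : groupType)
    (C : universal_cover X Phi) (d : 'rV[R]_4 -> 'rV[R]_4 -> R) (K : set 'rV[R]_4)
    (theta : R) (m l : Phi) :
  meridian_longitude C d K theta m l -> commute m l.
Proof.
move=> [e [f [len [ang [[e0 _] _ _ _ act]]]]].
have hr : 0 < e / 2 < e by rewrite divr_gt0 //= ltr_pdivrMr // ltr_pMr // ltr1n.
pose q := f (e / 2, 0, 0).
have eq : uc_act (m * l)%g q = uc_act (l * m)%g q.
  rewrite !uc_actM /q (proj1 (act _ _ _ hr)) !(proj2 (act _ _ _ hr)).
  by rewrite (proj1 (act _ _ _ hr)) addrAC.
have fix_q : uc_act ((l * m)^-1 * (m * l))%g q = q.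
  by rewrite uc_actM eq -uc_actM mulVg uc_act1.
have [U [_ Uq disj]] := uc_discontinuous q.
have lm1 : ((l * m)^-1 * (m * l) = 1)%g.
  apply: contrapT => /disj dj.
  by have : set0 q by rewrite -dj; split=> //; exists q.
by rewrite /commute -[LHS](mulVKg (l * m)%g) lm1 mulg1.
Qed.

Lemma displacement_diag (R : realType) (L : 'M[R[i]]_2) (g : R[i]) :
  displacement L g -> exists P : 'M[R[i]]_2, exists l1 l2,
    P \in unitmx /\ L = P *m mat2 l1 0 0 l2 *m invmx P.
Proof.
move=> [P uP [sgn ->]]; exists P.
exists ((-1) ^+ sgn * expC (g / 2)), ((-1) ^+ sgn * expC (- g / 2)); split=> //.
rewrite scalemxAl scalemxAr; congr (_ *m _ *m _).
by apply: mat2P; rewrite !mxE /= ?mulr1n ?mulr0n ?mulr0.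
Qed.

Lemma coshC_half (R : realType) (r phi : R) :
  coshC ((r +i* phi) / 2) =
  (coshR (r / 2) * cos (phi / 2)) +i* (sinhR (r / 2) * sin (phi / 2)).
Proof.
(* Trading division by 2 in [R[i]] for a doubling allows a comparison of real and imaginary
   parts. *)
have half (z w : R[i]) : z = w * 2 -> z / 2 = w by move->; rewrite mulfK ?pnatr_eq0.
have -> : (r +i* phi) / 2 = (r / 2) +i* (phi / 2).
  apply: half; rewrite mulr_natr mulr2n.
  by apply/eqP; rewrite eq_complex /= -!splitr !eqxx.
rewrite /coshC; apply: half; rewrite mulr_natr mulr2n /expC /coshR /sinhR.
simpc; rewrite /= cosN sinN.
by apply/eqP; rewrite eq_complex /=; apply/andP; split; apply/eqP; field.
Qed.

(** With X and Y as below, the squared moduli are 4 times (1 -+ X Y)^2 + (X^2 - 1) (1 - Y^2) = (X -+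
    Y)^2, and X > 1 >= |Y| fixes the sign of the square roots. *)
Lemma complex_length_norm (R : realType) (L : 'M[R[i]]_2) (r phi : R) :
  complex_length L (r +i* phi) ->
  let X := coshR (r / 2) in let Y := cos (phi / 2) in
  [/\ 1 < X, -1 <= Y <= 1, `|\tr L + 2| = (2 * (X - Y))%:C
    & `|\tr L - 2| = (2 * (X + Y))%:C].
Proof.
move=> [_ r0 cosh_tr] X Y; rewrite /= in r0.
have e2 : expR (r / 2) * expR (- (r / 2)) = 1.
  by rewrite expRN mulfV ?gt_eqF ?expR_gt0.
have X1 : 1 < X.
  have e1 : 1 < expR (r / 2) by rewrite expR_gt1 divr_gt0.
  have e0 : 0 < expR (- (r / 2)) by exact: expR_gt0.
  rewrite /X /coshR ltr_pdivlMr //; nra.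
have Y1 : -1 <= Y <= 1 by rewrite cos_geN1 cos_le1.
have XZ : sinhR (r / 2) ^+ 2 = X ^+ 2 - 1.
  by rewrite /X /coshR /sinhR; field: e2.
have YW : sin (phi / 2) ^+ 2 = 1 - Y ^+ 2.
  by apply: (addrI (Y ^+ 2)); rewrite cos2Dsin2 addrC subrK.
have trL : \tr L = - (2 * X * Y) +i* - (2 * (sinhR (r / 2) * sin (phi / 2))).
  have -> : \tr L = - coshC ((r +i* phi) / 2) * 2.
    by rewrite cosh_tr opprK divfK ?pnatr_eq0.
  rewrite coshC_half mulr_natr mulr2n; simpc.
  by apply/eqP; rewrite eq_complex /X /Y /=; apply/andP; split; apply/eqP; ring.
have two : 2 = 2%:C :> R[i] by rewrite rmorph_nat.
split=> //; rewrite normc_def trL two; simpc; congr (_%:C).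
  rewrite /= (_ : _ + _ = (2 * (X - Y)) ^+ 2).
    by rewrite sqrtr_sqr ger0_norm //; lra.
  transitivity ((2 - 2 * X * Y) ^+ 2 + 4 * sinhR (r / 2) ^+ 2 * sin (phi / 2) ^+ 2).
    by ring.
  by rewrite XZ YW; ring.
rewrite /= (_ : _ + _ = (2 * (X + Y)) ^+ 2).
  by rewrite sqrtr_sqr ger0_norm //; lra.
transitivity ((2 + 2 * X * Y) ^+ 2 + 4 * sinhR (r / 2) ^+ 2 * sin (phi / 2) ^+ 2).
  by ring.
by rewrite XZ YW; ring.
Qed.

Lemma complex_length_trace_neq (R : realType) (L : 'M[R[i]]_2) (r phi : R) :
  complex_length L (r +i* phi) -> \tr L + 2 != 0 /\ \tr L - 2 != 0.
Proof.
move=> /complex_length_norm[X1 /andP[Ym Yp] np nm].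
rewrite -(normr_eq0 (_ + 2)) -(normr_eq0 (_ - 2)) np nm !fmorph_eq0.
by rewrite !mulf_eq0 !pnatr_eq0 /=; split; rewrite gt_eqF //; lra.
Qed.

Lemma complex_sqr_sub4_neq0 (R : realType) (c : R) :
  c ^+ 2 < 1 -> (2 * c)%:C ^+ 2 - 4 != 0 :> R[i].
Proof.
move=> c1; have four : 4 = 4%:C :> R[i] by rewrite rmorph_nat.
by rewrite four -rmorphXn -rmorphB fmorph_eq0 exprMn lt_eqF //; lra.
Qed.

(** This supplies the nondegeneracy conditions of [longitude_trace]. As l1 l2 = 1, (tr L)^2 - 4 =
    (l1 - l2)^2, so tr L != 2, -2 makes the eigenvalues distinct. *)
Lemma loxodromic_longitude_trace (R : realType) (G : groupType)
    (h : G -> 'M[R[i]]_2) (p : nat) (s t : G) (r phi c : R) :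
  (forall g1 g2, h (g1 * g2)%g = h g1 *m h g2) -> (forall g, \det (h g) = 1) ->
  commute s (longitude p s t) ->
  complex_length (h (longitude p s t)) (r +i* phi) ->
  \tr (h s) = (2 * c)%:C -> c ^+ 2 < 1 ->
  let L := h (longitude p s t) in
  let x := \tr (h s) in let y := \tr (h t) in let z := \tr (h s *m h t) in
  (2 * z - x * y) ^+ 2 * (\tr L + 2) = y ^+ 2 * (x ^+ 2 - 4) * (\tr L - 2)
  /\ exists c, \tr L - 2 = c * (x ^+ 2 + z ^+ 2 - x * y * z).
Proof.
move=> hM hdet comm len trs c1 L x y z.
have [trLp trLm] := complex_length_trace_neq len.
have [/displacement_diag[P [l1 [l2 [uP eL]]]] _ _] := len.
have trL : \tr L = l1 + l2 by rewrite /L eL mxtrace_mulC mulKmx // mxtrace_mat2.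
have detL : l1 * l2 = 1.
  rewrite -(hdet (longitude p s t)) eL !det_mulmx mulrAC -det_mulmx mulmxV //.
  by rewrite det1 mul1r det_mat2 mul0r subr0.
apply: (longitude_trace hM hdet comm uP eL).
- apply: contraTneq (mulf_neq0 trLp trLm) => e; rewrite negbK.
  have -> : (\tr L + 2) * (\tr L - 2) = (l1 + l2) ^+ 2 - 4 by rewrite trL; ring.
  move: detL; rewrite -e => d1.
  by rewrite -[4]mulr1 -[X in _ - _ * X]d1; apply/eqP; ring.
- by rewrite -subr_eq0 /x trs complex_sqr_sub4_neq0.
- by rewrite -subr_eq0.
Qed.

(** * From the Tangent Rules to the Cosine Rule *)

(** [D] is the common value |2 z - x y|^2, which cancels when one rule is divided by the other. *)
Lemma cosine_rule_of_tangent_rule (R : realFieldType) (D Xa Ya Xb Yb ca cb : R) :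
  0 < D -> 1 < Xa -> -1 <= Ya <= 1 -> 1 < Xb -> -1 <= Yb <= 1 ->
  -1 <= ca < 1 -> -1 <= cb < 1 ->
  D * (Xa - Ya) = 4 * (1 + cb) * (1 - ca) * (Xa + Ya) ->
  D * (Xb - Yb) = 4 * (1 + ca) * (1 - cb) * (Xb + Yb) ->
  (Ya * Xb - Yb * Xa) / (Xa * Xb - Ya * Yb) = (ca - cb) / (1 - ca * cb).
Proof.
move=> D0 Xa1 /andP[Yam Yap] Xb1 /andP[Ybm Ybp] /andP[cam cap] /andP[cbm cbp] Ea Eb.
(* The value -1, a cone angle pi, would annihilate the right side of [Eb] while its left side is
   positive. This matters because 1 - ca cb vanishes at ca = cb = -1. *)
have ca1 : ca + 1 != 0.
  apply: contra_eq_neq Eb => ca1; rewrite [1 + ca]addrC ca1 mulr0 !mul0r.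
  by rewrite mulf_neq0 ?gt_eqF // subr_gt0; lra.
have ca2 : -1 < ca by rewrite lt_neqAle cam andbT eq_sym -subr_eq0 opprK.
have den1 : 0 < Xa * Xb - Ya * Yb by nra.
have den2 : 0 < 1 - ca * cb by nra.
apply/eqP; rewrite eqr_div ?lt0r_neq0 //; apply/eqP.
have cross : D * (Xa - Ya) * (4 * (1 + ca) * (1 - cb) * (Xb + Yb)) =
             4 * (1 + cb) * (1 - ca) * (Xa + Ya) * (D * (Xb - Yb)).
  by rewrite Ea Eb.
have D4 : 8 * D != 0 by rewrite mulf_neq0 ?gt_eqF.
apply: (mulfI D4); apply/eqP; rewrite eq_sym -subr_eq0; apply/eqP.
(* Write A / B and P / Q for the two fractions of the goal. The factors in [cross] are B -+ A and Q
   +- P, and (B - A) (Q + P) - (B + A) (Q - P) = 2 (P B - A Q); the remaining 4 D explains the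
   constant in [D4]. *)
transitivity (D * (Xa - Ya) * (4 * (1 + ca) * (1 - cb) * (Xb + Yb)) -
             4 * (1 + cb) * (1 - ca) * (Xa + Ya) * (D * (Xb - Yb))); first by ring.
by rewrite cross subrr.
Qed.

(** Here c1 and c2 are cosines of half cone angles, so 2 c^2 - 1 is the cosine of the full angle.
    Since c1^2 < 1, the modulus of x^2 - 4 is 4 - x^2. *)
Lemma tangent_rule_norm (R : realType) (d l : R[i]) (c1 c2 X Y : R) :
  c1 ^+ 2 < 1 -> `|l + 2| = (2 * (X - Y))%:C -> `|l - 2| = (2 * (X + Y))%:C ->
  d ^+ 2 * (l + 2) = (2 * c2)%:C ^+ 2 * ((2 * c1)%:C ^+ 2 - 4) * (l - 2) ->
  complex.Re `|d| ^+ 2 * (X - Y) =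
  4 * (1 + (2 * c2 ^+ 2 - 1)) * (1 - (2 * c1 ^+ 2 - 1)) * (X + Y).
Proof.
move=> c1lt1 np nm /(congr1 Num.norm); rewrite !normrM np nm.
have four : 4 = 4%:C :> R[i] by rewrite rmorph_nat.
have ny : `|(2 * c2)%:C| * `|(2 * c2)%:C| = (4 * c2 ^+ 2)%:C.
  rewrite -normrM -rmorphM ger0_norm; first by congr (_%:C); ring.
  by rewrite ler0c -expr2 sqr_ge0.
have nx : `|(2 * c1)%:C ^+ 2 - 4| = (4 - 4 * c1 ^+ 2)%:C.
  have -> : (2 * c1)%:C ^+ 2 - 4 = - (4 - 4 * c1 ^+ 2)%:C :> R[i].
    by rewrite four -rmorphXn -rmorphB -rmorphN; congr (_%:C); ring.
  by rewrite normrN ger0_norm // ler0c; lra.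
rewrite ny nx normc_def /= -!rmorphM => /complexI E.
by apply: (@mulfI _ 2); rewrite ?pnatr_eq0 // mulrCA E; ring.
Qed.

Lemma cos_half (R : realType) (a : R) : cos a = 2 * cos (a / 2) ^+ 2 - 1.
Proof. by rewrite {1}(splitr a) -mulr2n cos_mulr2n mulr_natl. Qed.

Lemma cos_half_sqr_lt1 (R : realType) (a : R) : 0 < a <= pi -> cos (a / 2) ^+ 2 < 1.
Proof.
move=> /andP[a0 api].
have : 0 < sin (a / 2).
  apply: sin_gt0_pi; rewrite divr_gt0 //= ltr_pdivrMr //.
  by rewrite (le_lt_trans api) // ltr_pMr ?pi_gt0 // ltr1n.
by have := cos2Dsin2 (a / 2); nra.
Qed.

Theorem theorem10 (R : realType) (p : nat) (alpha beta : R)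
    (halpha : 0 < alpha <= pi) (hbeta : 0 < beta <= pi)
    (d : 'rV[R]_4 -> 'rV[R]_4 -> R)
    (hd : hyperbolic_cone_metric (twist_link p 0) (twist_link p 1) alpha beta d)
    (Phi : groupType) (s t : Phi) (hPhi : twist_presentation p s t)
    (C : universal_cover (@twist_link_complement R p) Phi)
    (hs : meridian_longitude C d (twist_link p 0) alpha s (longitude p s t))
    (ht : meridian_longitude C d (twist_link p 1) beta t (longitude p t s))
    (h : Phi -> 'M[R[i]]_2) (hh : lifted_holonomy C d h)
    (hS : \tr (h s) = (2 * cos (alpha / 2))%:C)
    (hT : \tr (h t) = (2 * cos (beta / 2))%:C)
    (ra phia rb phib : R)
    (hga : complex_length (h (longitude p s t)) (ra +i* phia))
    (hgb : complex_length (h (longitude p t s)) (rb +i* phib)) :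
  (cos (phia / 2) * coshR (rb / 2) - cos (phib / 2) * coshR (ra / 2))
    / (coshR (ra / 2) * coshR (rb / 2) - cos (phia / 2) * cos (phib / 2))
  = (cos alpha - cos beta) / (1 - cos alpha * cos beta).
Proof.
have [hM hdet _] := hh.
have [Xa1 Ya1 npa nma] := complex_length_norm hga.
have [Xb1 Yb1 npb nmb] := complex_length_norm hgb.
have ca1 := cos_half_sqr_lt1 halpha; have cb1 := cos_half_sqr_lt1 hbeta.
have [E1 [c Lc]] := loxodromic_longitude_trace hM hdet
  (meridian_longitude_commute hs) hga hS ca1.
have [E2 _] := loxodromic_longitude_trace hM hdet
  (meridian_longitude_commute ht) hgb hT cb1.
(* Since tr TS = tr ST, both Tangent Rules involve the same z, hence the same 2 z - x y. *)
rewrite hS hT in E1 Lc; rewrite hS hT mxtrace_mulC in E2.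
set z := \tr (h s *m h t) in E1 E2 Lc.
set x := (2 * cos (alpha / 2))%:C in E1 E2 Lc.
set y := (2 * cos (beta / 2))%:C in E1 E2 Lc.
rewrite [y * x]mulrC in E2.
have Ea := tangent_rule_norm ca1 npa nma E1.
have Eb := tangent_rule_norm cb1 npb nmb E2.
have [_ trLm] := complex_length_trace_neq hga.
have [_ trLm'] := complex_length_trace_neq hgb.
(* Otherwise x = y = z = 0, and then tr L_S = 2. *)
have D0 : 2 * z - x * y != 0.
  apply/eqP=> D0.
  move: E1 E2; rewrite D0 expr0n !mul0r => /esym/eqP E1 /esym/eqP E2.
  have y0 : y = 0.
    move: E1; rewrite !mulf_eq0 (negPf trLm).
    by rewrite (negPf (complex_sqr_sub4_neq0 ca1)) !orbF orbb => /eqP.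
  have x0 : x = 0.
    move: E2; rewrite !mulf_eq0 (negPf trLm').
    by rewrite (negPf (complex_sqr_sub4_neq0 cb1)) !orbF orbb => /eqP.
  have z0 : z = 0.
    by apply/eqP; move/eqP: D0; rewrite x0 mul0r subr0 mulf_eq0 pnatr_eq0.
  by move: trLm; rewrite Lc x0 z0 expr0n !mul0r subr0 addr0 mulr0 eqxx.
rewrite -!cos_half in Ea Eb.
(* The lower bound is not strict, as the cone angle pi is allowed. *)
have range a : cos (a / 2) ^+ 2 < 1 -> -1 <= cos a < 1.
  by move=> ?; rewrite cos_geN1 cos_half; lra.
apply: cosine_rule_of_tangent_rule Ea Eb => //; [|exact: range..].
have : 0 < `|2 * z - x * y| by rewrite normr_gt0.
by rewrite (normc_def (2 * z - x * y)) ltcR => /exprn_gt0.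
Qed.
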